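(* For every $C>0$ there is a constant $c>0$ such that the following holds. If $p$ is a prime, $A \subseteq \mathbb{F}_p$ with $|A| = n < \log_2\log_8\log_{32} p - 1$ and $|A + A| \leq Cn$, then $|A \cdot A| \geq cn^2 /\log n$.
   Context: $A+A=\{a+b: a,b\in A\}$ and $A\cdot A=\{ab : a,b\in A\}$. *)

(* Defs.v *)
From mathcomp Require Import all_boot all_order all_algebra.
From mathcomp Require Import reals exp.

Set Implicit Arguments.
Unset Strict Implicit.
Unset Printing Implicit Defensive.

Import Order.TTheory GRing.Theory Num.Theory.
Local Open Scope ring_scope.

Definition sumset (F : finNzRingType) (A B : {set F}) : {set F} :=
  [set a + b | a in A, b in B].

Definition prodset (F : finNzRingType) (A B : {set F}) : {set F} :=
  [set a * b | a in A, b in B].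

(* The total function [ln] is 0 on nonpositive reals, hence so is [logb b]. *)
Definition logb (R : realType) (b x : R) : R := ln x / ln b.

(* Main.v *)
(** Proof idea.  The statement over [F_p] is transferred to the complex numbers.
    Passing to a subset [A'] of [A] without 0 and of size about [n / 8], the bound on
    [p] leaves room for a crude effective elimination: if [p] exceeds a triple
    exponential in [3 m], any finite system of integral polynomial equations of small
    degree and height in [m] unknowns that is solvable in [F_p] is solvable in [C].
    Unknowns are eliminated one at a time: after a linear change of variables one of
    the equations has a constant leading coefficient, and the Sylvester determinants
    against the other equations again vanish in [F_p].  An unknown playing the role of
    the inverse of [prod x_i * prod (x_i - x_j)] makes the transfer injective and nonzero.

    Over [C], following Solymosi and Konyagin-Rudnev, restrict to a quadrant [B] and
    group [B x B] by slopes.  If [s'] is the nearest neighbour of [s] among a set of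
    slopes, the sum of a point on the line of slope [s] and one on the line of slope
    [s'] has a slope [z] with [|z - s| < |s' - s|], and a given [z] occurs for at most
    8 values of [s], one for each octant around [z].  Hence there are at most
    [8 |B + B|^2 / t^2] slopes with at least [t] points; a dyadic summation bounds the
    multiplicative energy by [O(|B + B|^2 log |B|)], and Cauchy-Schwarz concludes. *)
Require Import Defs.
From mathcomp Require Import all_boot all_order all_algebra all_fingroup.
From mathcomp Require Import reals exp.
From mathcomp Require Import complex zify ring lra.
From Stdlib Require Import Classical.

Set Implicit Arguments.
Unset Strict Implicit.
Unset Printing Implicit Defensive.

Import Order.TTheory GRing.Theory Num.Theory.
Local Open Scope ring_scope.

(** * Integral polynomials of bounded degree and height *)

(* A polynomial is a list of terms [(c, w)]: the integer [c] times the product of the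
   unknowns listed in the word [w].  Words may be permuted and terms repeated, so the
   representation is not unique; only evaluations matter. *)
Definition wpoly := seq (int * seq nat).

Definition pev (S : comNzRingType) (s : nat -> S) (p : wpoly) : S :=
  \sum_(t <- p) t.1%:~R * \prod_(i <- t.2) s i.

Definition pdeg (m d : nat) (p : wpoly) : bool :=
  all (fun t => (size t.2 <= d)%N && all (fun i => (i < m)%N) t.2) p.

(** The sum of absolute values is preferred to their maximum as a height: it is subadditive and
    submultiplicative, with no factor counting monomials. *)
Definition pnorm (p : wpoly) : nat := (\sum_(t <- p) `|t.1|)%N.

Definition small (m d H : nat) (p : wpoly) : bool := pdeg m d p && (pnorm p <= H)%N.

Definition pcoef (m j : nat) (p : wpoly) : wpoly :=
  [seq (t.1, [seq i <- t.2 | i != m]) | t <- p & count_mem m t.2 == j].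

Definition phom (j : nat) (p : wpoly) : wpoly := [seq t <- p | size t.2 == j].

Lemma pev_ext (S : comNzRingType) (s s' : nat -> S) m d p :
  pdeg m d p -> (forall i, (i < m)%N -> s i = s' i) -> pev s p = pev s' p.
Proof.
move=> /allP pm ss'; apply: eq_big_seq => t /pm /andP[_ /allP tm].
by congr (_ * _); apply: eq_big_seq => i /tm; apply: ss'.
Qed.

Lemma pev_rmorph (S S' : comNzRingType) (f : {rmorphism S -> S'}) (s : nat -> S) p :
  pev (fun i => f (s i)) p = f (pev s p).
Proof.
rewrite /pev rmorph_sum; apply: eq_bigr => t _.
by rewrite rmorphM rmorph_int rmorph_prod.
Qed.

Lemma big_partition_nat (S : comNzRingType) (T : eqType) (r : seq T) (h : T -> nat)
    (F : T -> S) d : (forall t, t \in r -> (h t <= d)%N) ->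
  \sum_(t <- r) F t = \sum_(j < d.+1) \sum_(t <- r | h t == j) F t.
Proof.
move=> hd; rewrite (exchange_big_dep xpredT) //=; apply: eq_big_seq => t /hd td.
have jd : (h t < d.+1)%N by [].
by rewrite (big_pred1 (Ordinal jd)) // => j; rewrite -val_eqE eq_sym.
Qed.

Lemma pev_pcoef (S : comNzRingType) (s : nat -> S) m d p : pdeg m.+1 d p ->
  pev s p = \sum_(j < d.+1) pev s (pcoef m j p) * s m ^+ j.
Proof.
move=> /allP pm; rewrite /pev (@big_partition_nat _ _ p (fun t => count_mem m t.2) _ d); last first.
  by move=> t /pm /andP[td _]; apply: leq_trans td; apply: count_size.
apply: eq_bigr => j _; rewrite big_map big_filter mulr_suml; apply: eq_bigr => t /eqP tj.
rewrite -mulrA; congr (_ * _) => /=.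
rewrite (bigID (fun i => i != m)) /= big_filter; congr (_ * _).
under eq_bigl do rewrite negbK.
transitivity (\prod_(i <- t.2 | i == m) s m); first by apply: eq_bigr => i /eqP->.
by rewrite big_const_seq -tj iter_mulr_1.
Qed.

Lemma pnorm_filter (P : pred (int * seq nat)) p : (pnorm [seq t <- p | P t] <= pnorm p)%N.
Proof. by rewrite /pnorm big_filter [leqRHS](bigID P) leq_addr. Qed.

Lemma small_pcoef m d H j p : small m.+1 d H p -> small m d H (pcoef m j p).
Proof.
move=> /andP[/allP pm pH]; apply/andP; split.
  apply/allP => t' /mapP[t tp ->]; move: tp; rewrite mem_filter.
  move=> /andP[_ /pm /andP[td /allP tm]] /=.
  apply/andP; split.
    by rewrite size_filter; apply: leq_trans td; apply: count_size.
  by apply/allP => i; rewrite mem_filter => /andP[im /tm]; lia.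
by rewrite /pnorm big_map; apply: leq_trans pH; apply: pnorm_filter.
Qed.

Lemma pdeg_phom m d j p : pdeg m d p -> pdeg m j (phom j p).
Proof.
move=> /allP pm; apply/allP => t; rewrite mem_filter => /andP[/eqP<- /pm /andP[_ ->]].
by rewrite leqnn.
Qed.

Lemma pev_phom (S : comNzRingType) (s : nat -> S) m d p : pdeg m d p ->
  pev s p = \sum_(j < d.+1) pev s (phom j p).
Proof.
move=> /allP pm; rewrite /pev (@big_partition_nat _ _ p (fun t => size t.2) _ d); last first.
  by move=> t /pm /andP[].
by apply: eq_bigr => j _; rewrite big_filter.
Qed.

Lemma pdegW m m' d d' p : (m <= m')%N -> (d <= d')%N -> pdeg m d p -> pdeg m' d' p.
Proof.
move=> mm' dd' /allP pm; apply/allP => t /pm /andP[td /allP tm].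
rewrite (leq_trans td dd') /=; apply/allP => i /tm im; exact: leq_trans mm'.
Qed.

Lemma smallW m m' d d' H H' p :
  (m <= m')%N -> (d <= d')%N -> (H <= H')%N -> small m d H p -> small m' d' H' p.
Proof.
by move=> mm' dd' HH' /andP[/(pdegW mm' dd') pd pH]; apply/andP; split=> //; apply: leq_trans HH'.
Qed.

(* Working with evaluations in all rings at once lets the same determinant be read in
   [F_p], in [C] and in [{poly C}]. *)
Definition polyfun := forall S : comNzRingType, (nat -> S) -> S.

Definition represents (p : wpoly) (u : polyfun) :=
  forall (S : comNzRingType) (s : nat -> S), u S s = pev s p.

Definition rep (m d H : nat) (u : polyfun) := exists2 p, small m d H p & represents p u.

Lemma repW m m' d d' H H' u :
  (m <= m')%N -> (d <= d')%N -> (H <= H')%N -> rep m d H u -> rep m' d' H' u.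
Proof. by move=> mm' dd' HH' [p ps pu]; exists p => //; apply: smallW ps. Qed.

Lemma rep_pev m d H p : small m d H p -> rep m d H (fun S s => pev s p).
Proof. by exists p. Qed.

Lemma eq_rep m d H (u v : polyfun) : (forall S s, u S s = v S s) -> rep m d H u -> rep m d H v.
Proof. by move=> uv [p ps pu]; exists p => // S s; rewrite -uv. Qed.

Lemma rep_int m d (z : int) : rep m d `|z| (fun S s => z%:~R).
Proof.
exists [:: (z, [::])]; first by rewrite /small /pdeg /pnorm /= big_seq1 leqnn.
by move=> S s; rewrite /pev big_seq1 big_nil mulr1.
Qed.

Lemma rep_var m i : (i < m)%N -> rep m 1 1 (fun S s => s i).
Proof.
move=> im; exists [:: (1%Z, [:: i])]; first by rewrite /small /pdeg /pnorm /= big_seq1 im.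
by move=> S s; rewrite /pev !big_seq1 mul1r.
Qed.

Lemma rep_add m d H H' u v : rep m d H u -> rep m d H' v ->
  rep m d (H + H') (fun S s => u S s + v S s).
Proof.
move=> [p /andP[pd pH] pu] [q /andP[qd qH] qv]; exists (p ++ q).
  by rewrite /small /pdeg all_cat /pnorm big_cat leq_add // andbT; apply/andP.
by move=> S s; rewrite /pev big_cat pu qv.
Qed.

Lemma rep_mul m d d' H H' u v : rep m d H u -> rep m d' H' v ->
  rep m (d + d') (H * H') (fun S s => u S s * v S s).
Proof.
move=> [p /andP[/allP pd pH] pu] [q /andP[/allP qd qH] qv].
exists [seq (t.1 * t'.1, t.2 ++ t'.2) | t <- p, t' <- q].
  apply/andP; split.
    apply/allP => _ /allpairsP[[t t'] /= [/pd /andP[td tm] /qd /andP[td' tm'] ->]] /=.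
    by rewrite size_cat leq_add // all_cat tm tm'.
  rewrite /pnorm big_allpairs_dep /=; apply: leq_trans (leq_mul pH qH).
  by rewrite big_distrlr /=; apply: leq_sum => t _; apply: leq_sum => t' _; rewrite abszM.
move=> S s; rewrite pu qv /pev big_allpairs_dep big_distrlr /=.
apply: eq_bigr => t _; apply: eq_bigr => t' _; rewrite big_cat rmorphM /=; ring.
Qed.

Lemma rep_scale m d H u (z : int) : rep m d H u -> rep m d (`|z| * H) (fun S s => z%:~R * u S s).
Proof. by move=> ru; apply: (rep_mul (rep_int m 0 z) ru). Qed.

Lemma rep_opp m d H u : rep m d H u -> rep m d H (fun S s => - u S s).
Proof.
move=> /(@rep_scale _ _ _ _ (-1)); rewrite mul1n; apply: eq_rep => S s.
by rewrite rmorphN1 mulN1r.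
Qed.

Lemma rep_sum m d H (T : Type) (r : seq T) (u : T -> polyfun) :
  (forall t, rep m d H (u t)) -> rep m d (size r * H) (fun S s => \sum_(t <- r) u t S s).
Proof.
move=> ru; elim: r => [|t r IH].
  by apply: eq_rep (rep_int m d 0) => S s; rewrite big_nil.
by apply: eq_rep (rep_add (ru t) IH) => S s; rewrite big_cons.
Qed.

Lemma rep_prod m d H (T : eqType) (r : seq T) (u : T -> polyfun) :
  (forall t, t \in r -> rep m d H (u t)) ->
  rep m (size r * d) (H ^ size r) (fun S s => \prod_(t <- r) u t S s).
Proof.
elim: r => [_|t r IH ru].
  by apply: eq_rep (rep_int m 0 1) => S s; rewrite big_nil.
rewrite expnS mulSn.
apply: eq_rep (rep_mul (ru t (mem_head _ _)) (IH _)) => [S s|t' tr]; first by rewrite big_cons.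
by apply: ru; rewrite inE tr orbT.
Qed.

(** Leibniz expansion: [N!] signed products of [N] entries each. *)
Lemma rep_det m d H N (M : 'I_N -> 'I_N -> polyfun) :
  (forall i j, rep m d H (M i j)) ->
  rep m (N * d) (N`! * H ^ N) (fun S s => \det (\matrix_(i, j) M i j S s)).
Proof.
move=> rM.
have rP (g : {perm 'I_N}) : rep m (N * d) (H ^ N) (fun S s => (-1) ^+ g * \prod_i M i (g i) S s).
  have := @rep_prod m d H _ (enum 'I_N) _ (fun i _ => rM i (g i)).
  rewrite size_enum_ord => /(@rep_scale _ _ _ _ ((-1) ^+ g)).
  have -> : `|(-1 : int) ^+ g|%N = 1%N by case: (odd_perm g).
  rewrite mul1n; apply: eq_rep => S s.
  by rewrite rmorphXn rmorphN1 big_enum.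
have := rep_sum (enum {perm 'I_N}) rP.
rewrite -cardE card_Sn; apply: eq_rep => S s.
rewrite big_enum; apply: eq_bigr => g _; congr (_ * _); apply: eq_bigr => i _.
by rewrite mxE.
Qed.

(** Expanding a word of length at most [d] costs a factor [K ^ d]; positivity of [K] covers the
    shorter words. *)
Lemma rep_subst m m' d H K u (q : nat -> polyfun) : (0 < K)%N ->
  (forall i, (i < m)%N -> rep m' 1 K (q i)) -> rep m d H u ->
  rep m' d (H * K ^ d) (fun S s => u S (fun i => q i S s)).
Proof.
move=> K0 rq [p /andP[/allP pd pH] pu].
suff: rep m' d (pnorm p * K ^ d) (fun S s => pev (fun i => q i S s) p).
  by move/(repW (leqnn _) (leqnn _) (leq_mul pH (leqnn _))); apply: eq_rep => S s; rewrite pu.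
elim: p pd {pH pu} => [_|t p IH pd].
  apply: eq_rep (repW (leqnn _) (leqnn _) (leq0n _) (rep_int m' d 0)) => S s.
  by rewrite /pev big_nil.
have /andP[td /allP tm] := pd t (mem_head _ _).
rewrite /pnorm big_cons mulnDl.
apply: eq_rep (_ : rep _ _ _ (fun S s => t.1%:~R * \prod_(i <- t.2) q i S s + pev (fun i => q i S s) p)) => [S s|].
  by rewrite /pev big_cons.
apply: rep_add; last by apply: IH => t' t'p; apply: pd; rewrite inE t'p orbT.
apply: rep_scale; apply: (@repW m' m' (size t.2) d (K ^ size t.2) _) => //.
  by rewrite leq_pexp2l.
elim: (t.2) tm {td pd} => [_|i w IHw tm].
  by apply: eq_rep (rep_int m' 0 1) => S s; rewrite big_nil.
rewrite expnS /= -add1n.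
apply: eq_rep (rep_mul (rq i (tm i (mem_head _ _))) (IHw _)) => [S s|j jw].
  by rewrite big_cons.
by apply: tm; rewrite inE jw orbT.
Qed.

(** * Polynomial functions in characteristic zero *)

Section PolynomialFunctions.

Variable C : numClosedFieldType.

Lemma poly_nat_nonroot (q : {poly C}) d : q != 0 -> (size q <= d.+1)%N ->
  exists2 i, (1 <= i <= d.+1)%N & q.[i%:R] != 0.
Proof.
move=> q0 qd; apply: NNPP => noroot.
suff: (d.+1 < size q)%N by rewrite ltnNge qd.
have -> : d.+1 = size [seq (i%:R : C) | i <- iota 1 d.+1] by rewrite size_map size_iota.
apply: max_poly_roots => //; last first.
  by rewrite map_inj_uniq ?iota_uniq // => i j /eqP; rewrite eqr_nat => /eqP.
apply/allP => x /mapP[i id ->]; move: id; rewrite mem_iota => id.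
by apply/negPn/negP => rootN; apply: noroot; exists i => //; lia.
Qed.

(** Terms may cancel, so being zero has to mean vanishing in every ring. With the other unknowns
    fixed, more than [d] roots in the last one kill every coefficient; without unknowns, an integer
    that is 0 in [C] is 0. *)
Lemma pev_eq0 m d p : pdeg m d p -> (forall s : nat -> C, pev s p = 0) ->
  forall (S : comNzRingType) (s : nat -> S), pev s p = 0.
Proof.
elim: m p => [|m IH] p pd p0 S s.
  have pE (S' : comNzRingType) (s' : nat -> S') : pev s' p = (\sum_(t <- p) t.1)%:~R.
    rewrite /pev rmorph_sum; apply: eq_big_seq => t /(allP pd) /andP[_].
    by case: (t.2) => //; rewrite big_nil mulr1.
  have := p0 (fun=> 0); rewrite pE => /eqP; rewrite intr_eq0 => /eqP p00.
  by rewrite pE p00.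
rewrite (pev_pcoef s pd) big1 // => j _.
have cd i : pdeg m d (pcoef m i p).
  by have /andP[] : small m d (pnorm p) (pcoef m i p) by apply/small_pcoef/andP.
rewrite (IH _ (cd _)) ?mul0r // => b.
pose q := \poly_(i < d.+1) pev b (pcoef m i p).
suff q0 : q = 0 by have := coef_poly d.+1 (fun i => pev b (pcoef m i p)) j; rewrite -/q q0 coef0 ltn_ord.
apply/eqP; apply: contraT => /poly_nat_nonroot/(_ (size_poly _ _))[i _ /eqP[]].
rewrite horner_poly -[RHS](p0 (fun l => if l == m then i%:R else b l)) (pev_pcoef _ pd).
apply: eq_bigr => l _; rewrite eqxx; congr (_ * _); apply: pev_ext (cd _) _ => t tm.
by rewrite ltn_eqF.
Qed.

Lemma size_prod_linear (s : nat -> {poly C}) (w : seq nat) :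
  (forall i : nat, (size (s i) <= 2)%N) -> (size (\prod_(i <- w) s i)%R <= (size w).+1)%N.
Proof.
move=> s2; elim: w => [|i w IH]; first by rewrite big_nil size_poly1.
rewrite big_cons; apply: leq_trans (size_polyMleq _ _) _.
move: (s2 i) IH => /=; move: (size (s i)) => x; set y := size _; set z := size w.
by lia.
Qed.

Lemma size_pev (s : nat -> {poly C}) m d p : pdeg m d p ->
  (forall i : nat, (size (s i) <= 2)%N) -> (size (pev s p) <= d.+1)%N.
Proof.
move=> /allP pd s2; rewrite /pev big_seq; apply: (big_ind (fun q : {poly C} => (size q <= d.+1)%N)).
- by rewrite size_poly0.
- by move=> q q' qd qd'; apply: leq_trans (size_polyD _ _) _; rewrite geq_max qd.
move=> t /pd /andP[td _]; rewrite mulrzl -scaler_int.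
apply: leq_trans (size_scale_leq _ _) _.
exact: leq_trans (size_prod_linear _ s2) _.
Qed.

Lemma size_linear_poly (b c : C) : (size (b%:P + c%:P * 'X)%R <= 2)%N.
Proof.
apply: leq_trans (size_polyD _ _) _; rewrite geq_max (leq_trans (size_polyC_leq1 _)) //=.
apply: leq_trans (size_polyMleq _ _) _; rewrite size_polyX.
by have := size_polyC_leq1 c; lia.
Qed.

(** Along a line, the top coefficient of a form depends only on the direction: any factor [b i]
    lowers the degree. *)
Lemma coef_pev_phom (b c : nat -> C) e p :
  (pev (fun i => (b i)%:P + (c i)%:P * 'X) (phom e p))`_e = pev c (phom e p).
Proof.
rewrite /pev coef_sum; apply: eq_big_seq => t; rewrite mem_filter => /andP[/eqP <- _].
rewrite mulrzl -scaler_int coefZ; congr (_ * _); elim: (t.2) => [|i w IH].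
  by rewrite !big_nil coef1.
rewrite !big_cons mulrDl -mulrA coefD coefCM coefCM coefXM /= IH nth_default ?mulr0 ?add0r //.
by apply: size_prod_linear => l; apply: size_linear_poly.
Qed.

(** Coordinates are replaced by integers one at a time: a nonzero polynomial of degree at most [d]
    in one coordinate is nonzero at one of [1, ..., d + 1]. Excluding 0 keeps these integers
    invertible in large characteristic. *)
Lemma pev_int_nonzero m d p (s : nat -> C) : pdeg m d p -> pev s p != 0 ->
  exists2 c : nat -> nat, (forall i, 1 <= c i <= d.+1)%N & pev (fun i => (c i)%:R : C) p != 0.
Proof.
move=> pd ps.
suff [c cd cp] : exists2 c : nat -> nat, (forall i, 1 <= c i <= d.+1)%N &
    pev (fun i => if (i < m)%N then (c i)%:R else s i) p != 0.
  exists c => //; move: cp; congr (_ != 0); apply: pev_ext pd _ => i im.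
  by rewrite im.
elim: {1}m => [|j [c cd cp]]; first by exists (fun=> 1%N).
pose t i : {poly C} := if i == j then 'X else (if (i < j)%N then (c i)%:R else s i)%:P.
have tE x : (pev t p).[x] = pev (fun i => if i == j then x else if (i < j)%N then (c i)%:R else s i) p.
  rewrite -[LHS]/(horner_eval x (pev t p)) -pev_rmorph; apply: pev_ext pd _ => i _.
  by rewrite /t; case: ifP => _; [exact: hornerX | exact: hornerC].
have [||i id] := @poly_nat_nonroot (pev t p) d.
- apply: contraNneq cp => t0; have := tE (s j); rewrite t0 horner0 => ->.
  by apply/eqP; apply: pev_ext pd _ => i _; case: eqP => // ->; rewrite ltnn.
- apply: size_pev pd _ => i; rewrite /t; case: ifP; rewrite ?size_polyX //.
  by rewrite (leq_trans (size_polyC_leq1 _)).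
rewrite tE => cp'; exists (fun l => if l == j then i else c l).
  by move=> l; case: ifP.
move: cp'; congr (_ != 0); apply: pev_ext pd _ => l _.
by rewrite [(l < j.+1)%N]ltnS [(l <= j)%N]leq_eqVlt; case: (l == j).
Qed.

End PolynomialFunctions.

(* The rows of this matrix are the coefficients of ['X^i * f] for [i < d] and of
   ['X^i * g] for [i < e], where [f] and [g] have formal degrees [e] and [d]: unlike in
   [Sylvester_mx], the size does not depend on the leading coefficients, so that the
   determinant commutes with specialization. *)
Definition sylv (S : comNzRingType) (d e : nat) (f g : nat -> S) (i j : nat) : S :=
  if (i < d)%N then if (i <= j <= i + e)%N then f (j - i)%N else 0
  else if (i - d <= j <= i - d + d)%N then g (j - (i - d))%N else 0.

(** * Sylvester determinants with formal degrees *)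

Section Sylvester.

Variable K : fieldType.
Implicit Types (f g : nat -> K) (d e : nat).

Lemma sylv_row_l d e f g i : (i < d)%N ->
  \poly_(j < d + e) sylv d e f g i j = 'X^i * \poly_(j < e.+1) f j.
Proof.
move=> id; apply/polyP => j; rewrite coef_poly coefXnM coef_poly /sylv id.
by do !case: ifP => //; lia.
Qed.

Lemma sylv_row_r d e f g i : (i < e)%N ->
  \poly_(j < d + e) sylv d e f g (d + i) j = 'X^i * \poly_(j < d.+1) g j.
Proof.
move=> id; apply/polyP => j; rewrite coef_poly coefXnM coef_poly /sylv addKn.
by do !case: ifP => //; lia.
Qed.

(** The vector of powers of a common root is in the kernel; [0 < d] makes it nonempty, hence
    nonzero. *)
Lemma sylv_root d e f g x : (0 < d)%N ->
  root (\poly_(j < e.+1) f j) x -> root (\poly_(j < d.+1) g j) x ->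
  \det (\matrix_(i < d + e, j < d + e) sylv d e f g i j) = 0.
Proof.
move=> d0 fx gx; apply/eqP; rewrite -det_tr; apply/det0P.
exists (\row_(j < d + e) x ^+ j).
  have i0 : (0 < d + e)%N by rewrite addn_gt0 d0.
  apply/negP => /eqP/rowP/(_ (Ordinal i0)); rewrite !mxE expr0 => /eqP.
  by rewrite oner_eq0.
apply/rowP => i; rewrite !mxE.
transitivity ((\poly_(j < d + e) sylv d e f g i j).[x]).
  by rewrite horner_poly; apply: eq_bigr => j _; rewrite !mxE mulrC.
have [id|di] := ltnP i d.
  by rewrite sylv_row_l // hornerM (rootP fx) mulr0.
have ie : (i - d < e)%N by have := ltn_ord i; lia.
by rewrite -(subnKC di) sylv_row_r // hornerM (rootP gx) mulr0.
Qed.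

(** A vector in the left kernel encodes [u * F + w * G = 0] with [w] of degree less than [e].
    Coprimality gives [F %| w], so [w = 0] and then [u = 0]. *)
Lemma sylv_coprime d e f g : f e != 0 ->
  coprimep (\poly_(j < e.+1) f j) (\poly_(j < d.+1) g j) ->
  \det (\matrix_(i < d + e, j < d + e) sylv d e f g i j) != 0.
Proof.
set F := \poly_(j < e.+1) f j; set G := \poly_(j < d.+1) g j => fe cop.
apply/negP => /det0P[v v0 /rowP vM].
have sF : size F = e.+1 by rewrite size_poly_eq.
pose vn (i : nat) : K := oapp (v 0) 0 (insub i).
have vnE (i : 'I_(d + e)) : v 0 i = vn i by rewrite /vn valK.
pose u := \poly_(i < d) vn i; pose w := \poly_(i < e) vn (d + i)%N.
have uw : u * F + w * G = 0.
  have -> : u * F + w * G = \sum_(i < d + e) vn i *: \poly_(j < d + e) sylv d e f g i j.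
    rewrite big_split_ord /= /u /w !poly_def !mulr_suml; congr (_ + _); apply: eq_bigr => i _.
      by rewrite sylv_row_l // -scalerAl.
    by rewrite sylv_row_r // -scalerAl.
  apply/polyP => j; rewrite coef_sum coef0.
  have [jd|dj] := ltnP j (d + e); last first.
    by apply: big1 => i _; rewrite coefZ coef_poly ltnNge dj mulr0.
  have := vM (Ordinal jd); rewrite !mxE => vj; rewrite -[RHS]vj; apply: eq_bigr => i _.
  by rewrite coefZ coef_poly jd vnE mxE.
have Fw : F %| w.
  rewrite -(Gauss_dvdpl _ cop); have -> : w * G = - u * F by apply/eqP; rewrite mulNr -addr_eq0 addrC uw.
  exact: dvdp_mull.
have w0 : w = 0.
  apply/eqP; apply: contraT => w0; have := dvdp_leq w0 Fw.
  by rewrite sF leqNgt ltnS size_poly.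
have u0 : u = 0.
  move: uw; rewrite w0 mul0r addr0 => /eqP; rewrite mulf_eq0 -[F == 0]size_poly_eq0 sF orbF.
  by move=> /eqP.
case/negP: v0; apply/eqP/rowP => i; rewrite mxE vnE.
have [id|di] := ltnP i d.
  by have := coef_poly d vn i; rewrite id -/u u0 coef0.
have ie : (i - d < e)%N by have := ltn_ord i; lia.
by have := coef_poly e (fun i => vn (d + i)%N) (i - d)%N; rewrite ie -/w w0 coef0 subnKC.
Qed.

End Sylvester.

(** * Elimination of one unknown *)

(* The change of variables [x_i = y_i + c_i t] for [i < m] and [x_m = c_m t], where the
   new unknown [t] has index [m]. *)
Definition line_subst (m : nat) (c : nat -> nat) (i : nat) : polyfun :=
  fun S s => (if (i < m)%N then s i else 0) + (c i)%:Z%:~R * s m.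

(** Each unknown becomes a linear form of height at most [1 + d.+1], whence the factor
    [d.+2 ^ d]. *)
Lemma line_subst_coefs m c d H p : (forall i, (c i <= d.+1)%N) -> small m.+1 d H p ->
  exists2 f : nat -> wpoly, forall j, small m d (H * d.+2 ^ d) (f j) &
    forall (S : comNzRingType) (s : nat -> S),
      pev (fun i => line_subst m c i s) p = \sum_(j < d.+1) pev s (f j) * s m ^+ j.
Proof.
move=> cd ps.
have [|q qs qE] := @rep_subst m.+1 m.+1 d H d.+2 _ (line_subst m c) isT _ (rep_pev ps).
  move=> i im; rewrite -[d.+2]add1n /line_subst; apply: rep_add.
    case: (i < m)%N; first exact: rep_var.
    exact: repW (leqnn _) (leqnn _) _ (rep_int m.+1 1 0).
  have := rep_scale (c i)%:Z (rep_var (ltnSn m)); apply: repW => //.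
  by rewrite muln1 absz_nat.
exists (fun j => pcoef m j q) => [j|S s]; first exact: small_pcoef.
by rewrite qE; apply: pev_pcoef; case/andP: qs.
Qed.

Section Elimination.

Variables (k : fieldType) (C : numClosedFieldType).

(* Over an infinite field a suitable integral combination of the polynomials avoids all
   the points at once; each of the points excludes at most one multiplier per step. *)
Lemma common_nonvanishing (T : eqType) (pt : T -> nat -> C) (a : nat -> k) m d H L (rs : seq T) :
  (size rs <= L)%N ->
  (forall r, r \in rs -> exists p, [/\ small m d H p, pev a p = 0 & pev (pt r) p != 0]) ->
  exists g, [/\ small m d (H * L.+1 ^ size rs) g, pev a g = 0 &
    forall r, r \in rs -> pev (pt r) g != 0].
Proof.
elim: rs => [|r rs IH] sL rsP.
  by exists [::]; rewrite /small /pdeg /pnorm big_nil; split=> //; rewrite /pev big_nil.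
have [|t trs|g [gs ga gr]] := IH _ _; first exact: ltnW.
  by apply: rsP; rewrite inE trs orbT.
have [h [hs ha hr]] := rsP r (mem_head _ _).
pose bad := [seq - pev (pt t) h / pev (pt t) g | t <- r :: rs].
have [l lL lbad] : exists2 l : nat, (l <= (size rs).+1)%N & l%:R \notin bad.
  apply: NNPP => nol.
  have uiota : uniq [seq (i%:R : C) | i <- iota 0 (size rs).+2].
    by rewrite map_inj_uniq ?iota_uniq // => i j /eqP; rewrite eqr_nat => /eqP.
  have sbad : {subset [seq (i%:R : C) | i <- iota 0 (size rs).+2] <= bad}.
    move=> z /mapP[i id ->]; move: id; rewrite mem_iota => id.
    by apply/negPn/negP => ib; apply: nol; exists i => //; lia.
  by have := uniq_leq_size uiota sbad; rewrite !size_map size_iota /= ltnn.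
have [q qs qE] : rep m d (H * L.+1 ^ (size rs).+1) (fun S s => pev s h + l%:Z%:~R * pev s g).
  apply: repW (rep_add (rep_pev hs) (rep_scale l%:Z (rep_pev gs))) => //.
  rewrite absz_nat -{1}[H]muln1 mulnCA -mulnDr leq_mul2l expnS.
  have : (0 < L.+1 ^ size rs)%N by rewrite expn_gt0.
  move: (L.+1 ^ size rs)%N => X X0.
  suff : (l * X <= L * X)%N by lia.
  by rewrite leq_mul2r (leq_trans lL sL) orbT.
exists q; split=> //; first by rewrite -qE ha ga mulr0 addr0.
move=> t trs; rewrite -qE; apply: contraNneq lbad => hg.
(* At the new point [r], [g] may vanish; the combination then equals [h], which is nonzero there. *)
have g0 : pev (pt t) g != 0.
  move: trs; rewrite inE => /orP[/eqP tr|/gr //].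
  by apply: contraNneq hr => g0; move: hg; rewrite tr in g0 *; rewrite g0 mulr0 addr0 => ->.
apply/mapP; exists t => //; apply: (canRL (mulfK g0)).
by apply/eqP; rewrite -addr_eq0 addrC hg.
Qed.

(** The Leibniz bound for a Sylvester matrix of size at most [2 * d]. The factor [d.+1 ^ d] pays for
    the combination of equations, [d.+2 ^ d] for the change of variables. *)
Definition elim_norm (d H : nat) : nat :=
  ((2 * d)`! * (H * d.+1 ^ d * d.+2 ^ d) ^ (2 * d))%N.

(** If every small [p] vanishing at [a] is identically zero on [C], any point will do. Otherwise
    some such [p1] is nonzero and is restricted to the line through a zero [b] of the eliminated
    system. If none of its roots there were a common zero, a combination [g] would avoid them all,
    and its Sylvester determinant with [p1] would vanish at [y] but not at [b]. *)
Lemma elimination_step m d H (a : nat -> k) : (0 < d)%N -> (0 < H)%N ->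
  (forall i, (1 <= i <= d.+1)%N -> i%:R != 0 :> k) ->
  (forall y : nat -> k, exists b : nat -> C, forall p,
    small m (2 * d * d) (elim_norm d H) p -> pev y p = 0 -> pev b p = 0) ->
  exists b : nat -> C, forall p, small m.+1 d H p -> pev a p = 0 -> pev b p = 0.
Proof.
move=> d0 H0 knz IH.
case: (classic (exists p, [/\ small m.+1 d H p, pev a p = 0 &
   exists s : nat -> C, pev s p <> 0])) => [[p1 [p1s p1a [s0 s0p1]]]|no]; last first.
  exists (fun=> 0) => p ps pa; apply: NNPP => p0; apply: no; exists p; split=> //.
  by exists (fun=> 0).
have p1d : pdeg m.+1 d p1 by case/andP: p1s.
(* [e] is the true degree of [p1] on [C]: terms of higher degree may be listed but cancel. *)
have [e [ed [s1 Fe] Fgt]] : exists e, [/\ (e <= d)%N,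
    exists s : nat -> C, pev s (phom e p1) <> 0 &
    forall j, (e < j <= d)%N -> forall s : nat -> C, pev s (phom j p1) = 0].
  apply: NNPP => noe.
  suff all0 i : forall j, (d - i <= j <= d)%N -> forall s : nat -> C, pev s (phom j p1) = 0.
    by apply: s0p1; rewrite (pev_phom _ p1d) big1 // => j _; apply: (all0 d); have := ltn_ord j; lia.
  have step j : (j <= d)%N ->
      (forall l, (j < l <= d)%N -> forall s : nat -> C, pev s (phom l p1) = 0) ->
      forall s : nat -> C, pev s (phom j p1) = 0.
    by move=> jd jl s; apply: NNPP => sj; apply: noe; exists j; split=> //; exists s.
  elim: i => [|i IHi] j jd s.
    by apply: step => [|l ld]; [|exfalso]; lia.
  apply: step => [|l ld]; first by lia.
  by apply: IHi; lia.
(* [c] is a direction in which the top form of [p1] does not vanish, so that [p1] has a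
   constant leading coefficient along every line of direction [c]. *)
have [c c1 Fc] := pev_int_nonzero (pdeg_phom e p1d) (introN eqP Fe).
have {}c1 i : (1 <= c i <= d.+1)%N by have := c1 i; lia.
have cd i : (c i <= d.+1)%N by have /andP[] := c1 i.
pose lin (b : nat -> C) i : {poly C} := (if (i < m)%N then b i else 0)%:P + ((c i)%:R)%:P * 'X.
have linE (b : nat -> C) i :
    lin b i = line_subst m c i (fun i => if i == m then 'X else (b i)%:P).
  rewrite /lin /line_subst eqxx -pmulrn polyC_natr; case: ltnP => im; rewrite ?polyC0 //.
  by rewrite ltn_eqF.
have lin2 b i : (size (lin b i) <= 2)%N.
  exact: size_linear_poly.
have polyE p (f : nat -> wpoly) (b : nat -> C) : (forall j, pdeg m d (f j)) ->
    (forall (S : comNzRingType) (s : nat -> S),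
      pev (fun i => line_subst m c i s) p = \sum_(j < d.+1) pev s (f j) * s m ^+ j) ->
    pdeg m.+1 d p -> pev (lin b) p = \poly_(j < d.+1) pev b (f j).
  move=> fd fE pd.
  rewrite (@pev_ext _ _ (fun i => line_subst m c i (fun i => if i == m then 'X else (b i)%:P)) _ _ _ pd); last first.
    by move=> i _; rewrite linE.
  rewrite fE poly_def; apply: eq_bigr => j _; rewrite eqxx -mul_polyC; congr (_ * _).
  rewrite -(pev_rmorph polyC b); apply: pev_ext (fd j) _ => i im.
  by rewrite ltn_eqF.
have hornerE p b (x : C) : (pev (lin b) p).[x] = pev (fun i => (lin b i).[x]) p.
  by rewrite -[LHS]/(horner_eval x _) -pev_rmorph.
have lin_size b : (size (pev (lin b) p1) <= e.+1)%N.
  rewrite (pev_phom _ p1d); apply: (big_ind (fun q : {poly C} => (size q <= e.+1)%N)).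
  - by rewrite size_poly0.
  - by move=> q q' qd qd'; apply: leq_trans (size_polyD _ _) _; rewrite geq_max qd.
  move=> j _; have [je|ej] := leqP j e.
    apply: leq_trans (size_pev (pdeg_phom j p1d) (lin2 b)) _; lia.
  rewrite (pev_eq0 (pdeg_phom j p1d) (Fgt j _)) ?size_poly0 //.
  by have := ltn_ord j; lia.
have lin_lead b : (pev (lin b) p1)`_e != 0.
  rewrite (pev_phom _ p1d) coef_sum.
  have ed' : (e < d.+1)%N by [].
  rewrite (bigD1 (Ordinal ed')) //= big1 ?addr0 ?coef_pev_phom // => j je.
  have [je'|ej] := ltnP j e.
    rewrite nth_default //; apply: leq_trans (size_pev (pdeg_phom j p1d) (lin2 b)) _; lia.
  rewrite (pev_eq0 (pdeg_phom j p1d) (Fgt j _)) ?coef0 //.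
  by have := ltn_ord j; move: je; rewrite -val_eqE /=; lia.
have [f fs fE] := line_subst_coefs cd p1s.
have fd j : pdeg m d (f j) by case/andP: (fs j).
(* These coefficients vanish in [k] as well as in [C], so [e] is a valid formal degree on both
   sides. *)
have f0 j : (e < j <= d)%N -> forall (S : comNzRingType) (s : nat -> S), pev s (f j) = 0.
  move=> jd; apply: (@pev_eq0 C _ _ _ (fd j)) => b.
  have := coef_poly d.+1 (fun j => pev b (f j)) j.
  rewrite -(polyE _ _ b fd fE p1d) nth_default; last by apply: leq_trans (lin_size b) _; lia.
  by case: ifP => // ; lia.
(* The inverse change of variables: [a] is the point of parameter [x] on the line through [y] of
   direction [c]. *)
pose x := a m / (c m)%:R; pose y i := if i == m then x else a i - (c i)%:R * x.
have aE i : (i < m.+1)%N -> a i = line_subst m c i y.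
  rewrite ltnS leq_eqVlt /line_subst /y eqxx -pmulrn => /orP[/eqP ->|im].
    by rewrite ltnn add0r mulrC divfK // knz.
  by rewrite im ltn_eqF // subrK.
have [b bP] := IH y.
have Q1 : pev (lin b) p1 = \poly_(j < e.+1) pev b (f j).
  apply/polyP => j; rewrite (polyE _ _ b fd fE p1d) !coef_poly.
  have [je|ej] := ltnP j e.+1; first by rewrite (leq_trans je) // ltnS.
  by case: ifP => // jd; rewrite f0 //; lia.
pose Q := pev (lin b) p1.
have sQ : size Q = e.+1.
  by rewrite /Q Q1 size_poly_eq //; have := lin_lead b; rewrite Q1 coef_poly ltnSn.
have Q0 : Q != 0 by rewrite -size_poly_eq0 sQ.
have [rs Qrs] := closed_field_poly_normal Q.
have srs : size rs = e.
  have := sQ; rewrite Qrs size_scale ?lead_coef_eq0 // size_prod_XsubC => -[]; exact.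
have rootrs r : root Q r = (r \in rs).
  by rewrite Qrs rootZ ?lead_coef_eq0 // root_prod_XsubC.
pose pt (r : C) i := (lin b i).[r].
case: (classic (exists2 r, r \in rs &
   forall p, small m.+1 d H p -> pev a p = 0 -> pev (pt r) p = 0)) => [[r _ rP]|nor].
  by exists (pt r).
exfalso.
have [||g [gs ga gr]] := @common_nonvanishing C pt a m.+1 d H d rs.
- by rewrite srs.
- move=> r rrs; apply: NNPP => nop; apply: nor; exists r => // p ps pa.
  by apply: NNPP => pr; apply: nop; exists p; split=> //; apply/eqP.
have {}gs : small m.+1 d (H * d.+1 ^ d) g.
  by apply: smallW gs => //; rewrite leq_mul2l srs leq_pexp2l ?orbT.
have [h hs hE] := line_subst_coefs cd gs.
have hd j : pdeg m d (h j) by case/andP: (hs j).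
have gd : pdeg m.+1 d g by case/andP: gs.
set H3 := (H * d.+1 ^ d * d.+2 ^ d)%N in hs.
have H3gt0 : (0 < H3)%N by rewrite !muln_gt0 H0 !expn_gt0.
have {}fs j : small m d H3 (f j).
  apply: smallW (fs j) => //; rewrite leq_mul2r; apply/orP; right.
  by rewrite leq_pmulr // expn_gt0.
have [q qs qE] : rep m (2 * d * d) (elim_norm d H) (fun S s =>
    \det (\matrix_(i < d + e, j < d + e) sylv d e (fun j => pev s (f j)) (fun j => pev s (h j)) i j)).
  apply: repW (@rep_det m d H3 (d + e) (fun i j S s =>
    sylv d e (fun j => pev s (f j)) (fun j => pev s (h j)) i j) _) => //.
  - by rewrite leq_mul2r; lia.
  - apply: leq_mul; first by apply: leq_fact; lia.
    by rewrite leq_pexp2l //; lia.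
  move=> i j; rewrite /sylv.
  have rep0 : rep m d H3 (fun S _ => 0) by apply: repW (rep_int m d 0).
  case: (i < d)%N; first by case: (i <= j <= i + e)%N; first exact: rep_pev.
  by case: (i - d <= j <= i - d + d)%N; first exact: rep_pev.
suff detb : \det (\matrix_(i < d + e, j < d + e)
    sylv d e (fun j => pev b (f j)) (fun j => pev b (h j)) i j) != 0.
  case/eqP: detb; rewrite qE; apply: bP => //; rewrite -qE.
  have ya p : pdeg m.+1 d p -> pev (fun i => line_subst m c i y) p = pev a p.
    by move=> pd; apply: esym; apply: pev_ext pd aE.
  have ym : y m = x by rewrite /y eqxx.
  apply: (@sylv_root _ _ _ _ _ x) => //; rewrite /root horner_poly; last first.
    by rewrite -[X in _ == X]ga -(ya _ gd) hE ym.
  rewrite -[X in _ == X]p1a -(ya _ p1d) fE ym.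
  rewrite (big_ord_widen d.+1 (fun j => pev y (f j) * x ^+ j)) // [eqbRHS](bigID (fun j : 'I_d.+1 => j < e.+1)%N) /=.
  rewrite [X in _ + X]big1 ?addr0 // => j ej; rewrite f0 ?mul0r //.
  by have := ltn_ord j; lia.
apply: sylv_coprime.
  by have := lin_lead b; rewrite Q1 coef_poly ltnSn.
rewrite -Q1 -(polyE _ _ b hd hE gd); apply: Pdiv.ClosedField.root_coprimep => r.
by rewrite rootrs hornerE => /gr.
Qed.

End Elimination.

(** * Transfer from large characteristic to characteristic zero *)

(** One parameter controls degree [D] and height [2 ^ D] together: an elimination leads to degree
    [2 * D ^ 2] and height at most [2 ^ (16 * D ^ 3)]. *)
Fixpoint elim_deg (m D : nat) : nat := if m is m'.+1 then elim_deg m' (16 * D ^ 3) else D.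

(** After multiplication by 4 each step is a cubing, as [4 * 16 = 4 ^ 3]. *)
Lemma elim_degE m D : (4 * elim_deg m D = (4 * D) ^ (3 ^ m))%N.
Proof.
elim: m D => [|m IH] D; first by rewrite /= expn1.
by rewrite /= IH [(3 ^ m.+1)%N]expnS expnM; congr (_ ^ _)%N; rewrite expnMn mulnA.
Qed.

Lemma leq_elim_deg m D : (0 < D)%N -> (D <= elim_deg m D)%N.
Proof.
move=> D0; rewrite -(@leq_pmul2l 4) // elim_degE -{1}[(4 * D)%N]expn1.
by rewrite leq_pexp2l ?expn_gt0 // muln_gt0.
Qed.

Lemma leq_elim_norm D : (0 < D)%N -> (elim_norm D (2 ^ D) <= 2 ^ (16 * D ^ 3))%N.
Proof.
move=> D0; rewrite /elim_norm.
have fN N : (N`! <= N ^ N)%N.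
  elim: N => // N IH; rewrite factS expnS leq_mul2l; apply: leq_trans IH _.
  by case: N => // N; rewrite leq_exp2r.
have l1 : ((2 * D)`! <= 2 ^ (4 * D ^ 2))%N.
  apply: leq_trans (fN _) _.
  apply: (@leq_trans ((2 ^ (2 * D)) ^ (2 * D))%N).
    by rewrite leq_exp2r ?muln_gt0 //; apply/ltnW/ltn_expl.
  by rewrite -expnM leq_pexp2l //; lia.
have l2 : (D.+1 ^ D <= 2 ^ (D ^ 2))%N.
  by rewrite -mulnn expnM leq_exp2r // ltn_expl.
have l3 : (D.+2 ^ D <= 2 ^ (2 * D ^ 2))%N.
  rewrite -mulnn mulnA expnM leq_exp2r //; apply: (@leq_trans (2 ^ D.+1)).
    exact: ltn_expl.
  by rewrite leq_pexp2l //; lia.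
have l4 : (2 ^ D * D.+1 ^ D * D.+2 ^ D <= 2 ^ (4 * D ^ 2))%N.
  apply: leq_trans (leq_mul (leq_mul (leqnn _) l2) l3) _.
  by rewrite -!expnD leq_pexp2l //; nia.
apply: (@leq_trans (2 ^ (4 * D ^ 2) * (2 ^ (4 * D ^ 2)) ^ (2 * D))%N).
  by apply: leq_mul => //; rewrite leq_exp2r // muln_gt0.
by rewrite -expnM -expnD leq_pexp2l //; nia.
Qed.

Section Transfer.

Variables (k : fieldType) (C : numClosedFieldType).

(** Once no unknown is left, the polynomials are integers of absolute value at most
    [2 ^ elim_deg m D], which vanish in [k] only if they are 0. *)
Lemma transfer_zeros m D (a : nat -> k) : (0 < D)%N ->
  (forall z : int, (`|z| <= 2 ^ elim_deg m D)%N -> z%:~R = 0 :> k -> z = 0) ->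
  exists b : nat -> C, forall p, small m D (2 ^ D) p -> pev a p = 0 -> pev b p = 0.
Proof.
elim: m D a => [|m IH] D a D0 kz.
  exists (fun=> 0) => p /andP[/allP pd pD].
  have pE (S : comNzRingType) (s : nat -> S) : pev s p = (\sum_(t <- p) t.1)%:~R.
    rewrite /pev rmorph_sum; apply: eq_big_seq => t /pd /andP[_].
    by case: (t.2) => //; rewrite big_nil mulr1.
  rewrite !pE => /kz -> //; apply: leq_trans pD; rewrite /pnorm.
  apply: (big_ind2 (fun (x : int) (y : nat) => (`|x| <= y)%N)) => // x1 y1 x2 y2; lia.
have D3 : (0 < 16 * D ^ 3)%N by rewrite muln_gt0 expn_gt0 D0.
apply: elimination_step => //; first by rewrite expn_gt0.
  move=> i iD; apply/negP => /eqP i0.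
  suff : (i : int) = 0 by lia.
  apply: kz => //; rewrite absz_nat; apply: (@leq_trans D.+1); first by lia.
  apply: leq_trans (ltn_expl D (isT : 1 < 2)%N) _.
  by rewrite leq_pexp2l // leq_elim_deg.
move=> y; have [|b bP] := IH _ y D3; first by [].
exists b => p ps; apply: bP; apply: smallW ps => //; last exact: leq_elim_norm.
by nia.
Qed.

Lemma transfer_ring_relations m (a : nat -> k) :
  (forall z : int, (`|z| <= 2 ^ elim_deg m.+1 (m ^ 2 + m + 2))%N -> z%:~R = 0 :> k -> z = 0) ->
  (forall i, (i < m)%N -> a i != 0) ->
  (forall i j, (i < m)%N -> (j < m)%N -> i != j -> a i != a j) ->
  exists b : nat -> C,
  [/\ forall i, (i < m)%N -> b i != 0,
      forall i j, (i < m)%N -> (j < m)%N -> i != j -> b i != b j,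
      forall i j u v, (i < m)%N -> (j < m)%N -> (u < m)%N -> (v < m)%N ->
        a i + a j = a u + a v -> b i + b j = b u + b v &
      forall i j u v, (i < m)%N -> (j < m)%N -> (u < m)%N -> (v < m)%N ->
        a i * a j = a u * a v -> b i * b j = b u * b v].
Proof.
(* The equation making the unknown [m] inverse to [disc] has degree at most [m ^ 2 + m + 1] and
   height at most [2 ^ (m ^ 2) + 1]. The summand 2 also secures [4 <= 2 ^ D] for the additive
   relations. *)
set D := (m ^ 2 + m + 2)%N => kz a0 ainj.
have D0 : (0 < D)%N by rewrite /D addn2.
(* The unknown of index [m] stands for the inverse of [disc]. *)
pose r := [seq (i, j) | i <- iota 0 m, j <- iota 0 m].
(* Diagonal pairs contribute 1, so that [r] can be the full square. *)
pose dif (t : nat * nat) : polyfun := fun S s => if t.1 == t.2 then 1 else s t.1 - s t.2.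
pose disc : polyfun := fun S s => (\prod_(i <- iota 0 m) s i) * (\prod_(t <- r) dif t S s).
pose a' i := if i == m then (disc k a)^-1 else a i.
have a'E i : (i < m)%N -> a' i = a i by move=> im; rewrite /a' ltn_eqF.
have memr i j : (i < m)%N -> (j < m)%N -> (i, j) \in r.
  by move=> im jm; rewrite allpairs_f // mem_iota.
have rm t : t \in r -> (t.1 < m)%N && (t.2 < m)%N.
  by case/allpairsP => -[i j] /= []; rewrite !mem_iota /= => im jm ->; rewrite im.
have disc_eq : disc k a' = disc k a.
  congr (_ * _); apply: eq_big_seq => i; first by rewrite mem_iota => im; apply: a'E.
  by move=> /rm /andP[i1 i2]; rewrite /dif !a'E.
have disc0 : disc k a != 0.
  rewrite /disc mulf_neq0 // prodf_seq_neq0; apply/allP => i /=.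
    by rewrite mem_iota; apply: a0.
  move=> /rm /andP[i1 i2]; rewrite /dif; case: (boolP (i.1 == i.2)) => [_|ne]; first exact: oner_neq0.
  by rewrite subr_eq0 ainj.
have [b bP] := transfer_zeros a' D0 kz.
have {}bP d H u : rep m.+1 d H u -> (d <= D)%N -> (H <= 2 ^ D)%N -> u k a' = 0 -> u C b = 0.
  by move=> [p ps pu] dD HD; rewrite !pu; apply: bP; apply: smallW ps.
have V i : (i < m)%N -> rep m.+1 1 1 (fun S s => s i) by move=> im; apply: rep_var; rewrite ltnS ltnW.
have D4 : (4 <= 2 ^ D)%N by rewrite -[4%N]/(2 ^ 2)%N leq_pexp2l // /D; lia.
have discb : b m * disc C b = 1.
  apply/eqP; rewrite -subr_eq0; apply/eqP.
  have r1 : rep m.+1 (size (iota 0 m) * 1) (1 ^ size (iota 0 m)) (fun S s => \prod_(i <- iota 0 m) s i).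
    by apply: (@rep_prod _ _ _ _ _ (fun i S s => s i)) => i; rewrite mem_iota; apply: V.
  have r2 : rep m.+1 (size r * 1) (2 ^ size r) (fun S s => \prod_(t <- r) dif t S s).
    apply: rep_prod => t /rm /andP[t1 t2]; rewrite /dif; case: (t.1 == t.2).
      exact: repW (rep_int m.+1 1 1).
    exact: (rep_add (V _ t1) (rep_opp (V _ t2))).
  have r3 := rep_add (rep_mul (rep_var (ltnSn m)) (rep_mul r1 r2)) (rep_int _ _ (-1)).
  have := bP _ _ _ r3; rewrite rmorphN1; apply.
  - by rewrite size_allpairs !size_iota /D; lia.
  - rewrite size_allpairs !size_iota exp1n !mul1n /D -addnA expnD.
    rewrite mulnn; have : (0 < 2 ^ (m ^ 2))%N by rewrite expn_gt0.
    have : (2 <= 2 ^ (m + 2))%N by rewrite -{1}[2%N]expn1 leq_pexp2l // addn2.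
    by nia.
  by rewrite -/(disc k a') disc_eq /a' eqxx mulVf // subrr.
have {}disc0 : disc C b != 0 by apply: contra_eq_neq discb => ->; rewrite mulr0 eq_sym oner_neq0.
move: disc0; rewrite /disc mulf_eq0 negb_or !prodf_seq_neq0 => /andP[/allP bn0 /allP bneq].
exists b; split.
- by move=> i im; apply: (bn0 i); rewrite mem_iota.
- move=> i j im jm ij; have := bneq _ (memr _ _ im jm).
  by rewrite /dif /= (negPf ij) subr_eq0.
- move=> i j u v im jm um vm eqa; apply/eqP; rewrite -subr_eq0; apply/eqP.
  apply: (bP _ _ _ (rep_add (rep_add (V i im) (V j jm)) (rep_opp (rep_add (V u um) (V v vm))))) => //.
  by rewrite !a'E // eqa subrr.
move=> i j u v im jm um vm eqa; apply/eqP; rewrite -subr_eq0; apply/eqP.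
apply: (bP _ _ _ (rep_add (rep_mul (V i im) (V j jm)) (rep_opp (rep_mul (V u um) (V v vm))))) => //.
- by rewrite /D; lia.
- exact: leq_trans D4.
by rewrite !a'E // eqa subrr.
Qed.

End Transfer.

(** * Nearest neighbours in the complex plane *)

Section ComplexGeometry.

Variable R : rcfType.
Local Notation Cx := (complex R).

Definition sqn (z : Cx) : R := complex.Re z ^+ 2 + complex.Im z ^+ 2.
Definition dotp (z w : Cx) : R :=
  complex.Re z * complex.Re w + complex.Im z * complex.Im w.

Lemma sqnM z w : sqn (z * w) = sqn z * sqn w.
Proof. by case: z => a b; case: w => c d; rewrite /sqn /=; ring. Qed.

Lemma sqnD z w : sqn (z + w) = sqn z + sqn w + 2 * dotp z w.
Proof. by case: z => a b; case: w => c d; rewrite /sqn /dotp /=; ring. Qed.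

Lemma sqnN z : sqn (- z) = sqn z.
Proof. by case: z => a b; rewrite /sqn /=; ring. Qed.

Lemma sqn_gt0 z : (0 < sqn z) = (z != 0).
Proof.
case: z => a b; rewrite /sqn eq_complex /= lt_neqAle addr_ge0 ?sqr_ge0 // andbT eq_sym.
by rewrite paddr_eq0 ?sqr_ge0 // !sqrf_eq0.
Qed.

(** Each value describes a sector of opening [pi / 4]. *)
Definition octant (z : Cx) : bool * bool * bool :=
  (0 <= complex.Re z, 0 <= complex.Im z, `|complex.Re z| <= `|complex.Im z|).

(** The angle between [u] and [v] is at most [pi / 4], hence below [pi / 3], so the side [u - v] is
    not the longest. Symmetries reduce every case to the octant [0 <= y <= x] of [core]. *)
Lemma octant_dist u v : octant u = octant v -> sqn u <= sqn v -> sqn (u - v) <= sqn v.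
Proof.
rewrite sqnD sqnN.
have core (x y x' y' : R) : 0 <= y <= x -> 0 <= y' <= x' ->
    x ^+ 2 + y ^+ 2 <= x' ^+ 2 + y' ^+ 2 -> x ^+ 2 + y ^+ 2 <= 2 * (x * x' + y * y').
  move=> /andP[y0 yx] /andP[y'0 y'x'] h.
  have l : x ^+ 2 + y ^+ 2 <= 2 * (x * x').
    rewrite -ler_sqr ?nnegrE; first last.
    - by nra.
    - by nra.
    have -> : (2 * (x * x')) ^+ 2 = (2 * x ^+ 2) * (2 * x' ^+ 2) by ring.
    rewrite expr2; apply: ler_pM; nra.
  by nra.
case: u => x y; case: v => x' y'; rewrite /octant /sqn /dotp /= => -[].
case: (lerP 0 x) => hx; case: (lerP 0 x') => // hx' _;
  case: (lerP 0 y) => hy; case: (lerP 0 y') => // hy' _;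
  rewrite ?(ger0_norm hx) ?(ger0_norm hx') ?(ger0_norm hy) ?(ger0_norm hy')
    ?(ltr0_norm hx) ?(ltr0_norm hx') ?(ltr0_norm hy) ?(ltr0_norm hy');
  case: lerP => h1; case: lerP => // h2 _ h.
- have := core y x y' x'; lra.
- have := core x y x' y'; lra.
- have := core (- y) x (- y') x'; lra.
- have := core x (- y) x' (- y'); lra.
- have := core y (- x) y' (- x'); lra.
- have := core (- x) y (- x') y'; lra.
- have := core (- y) (- x) (- y') (- x'); lra.
- have := core (- x) (- y) (- x') (- y'); lra.
Qed.

(** The left difference is the right one times [a2 / (a1 + a2)], and [a1 + a2] is longer than [a2]
    because the dot product is nonnegative. *)
Lemma mediant_dist (a1 b1 a2 b2 : Cx) : a1 != 0 -> a2 != 0 -> 0 <= dotp a1 a2 ->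
  b1 / a1 != b2 / a2 ->
  sqn (b1 / a1 - (b1 + b2) / (a1 + a2)) < sqn (b1 / a1 - b2 / a2).
Proof.
move=> a10 a20 a12 ne.
have lt : sqn a2 < sqn (a1 + a2) by move: a10; rewrite -sqn_gt0 sqnD; lra.
have a0 : a1 + a2 != 0 by rewrite -sqn_gt0; apply: le_lt_trans lt; rewrite ltW ?sqn_gt0.
have -> : b1 / a1 - (b1 + b2) / (a1 + a2) = (b1 / a1 - b2 / a2) * (a2 / (a1 + a2)).
  by field; rewrite a0 a10 a20.
rewrite sqnM -[ltRHS]mulr1 ltr_pM2l; last by rewrite sqn_gt0 subr_eq0.
have : sqn (a1 + a2) > 0 by rewrite sqn_gt0.
move=> pos; rewrite -(ltr_pM2r pos) -sqnM divfK // mul1r //.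
Qed.

Lemma nearest_exists (S : seq Cx) (s : Cx) : has (fun t => t != s) S ->
  exists t, [/\ t \in S, t != s & forall u, u \in S -> u != s -> sqn (s - t) <= sqn (s - u)].
Proof.
elim: S => // x S IH /=.
have [->|xs] := eqVneq x s.
  move=> /= /IH [t [tS ts tmin]]; exists t; split=> //; first by rewrite inE tS orbT.
  by move=> u; rewrite inE => /orP[/eqP ->|]; [rewrite eqxx|apply: tmin].
case: (boolP (has (fun t => t != s) S)) => [/IH [t [tS ts tmin]] _|noS _]; last first.
  exists x; split=> //; first exact: mem_head.
  move=> u; rewrite inE => /orP[/eqP -> //|uS us].
  by case/hasP: noS; exists u.
have [le|lt] := lerP (sqn (s - t)) (sqn (s - x)).
  exists t; split=> //; first by rewrite inE tS orbT.
  by move=> u; rewrite inE => /orP[/eqP -> //|]; apply: tmin.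
exists x; split=> //; first exact: mem_head.
move=> u; rewrite inE => /orP[/eqP -> //|uS us].
exact: le_trans (ltW lt) (tmin u uS us).
Qed.

(* Equal to [s] when [S] has no other element. *)
Definition nearest (S : seq Cx) (s : Cx) : Cx :=
  head s [seq t <- S | (t != s) && all (fun u => (u != s) ==> (sqn (s - t) <= sqn (s - u))) S].

Lemma nearestP (S : seq Cx) (s : Cx) : has (fun t => t != s) S ->
  [/\ nearest S s \in S, nearest S s != s &
    forall u, u \in S -> u != s -> sqn (s - nearest S s) <= sqn (s - u)].
Proof.
move=> /nearest_exists [t [tS ts tmin]].
pose P t := (t != s) && all (fun u => (u != s) ==> (sqn (s - t) <= sqn (s - u))) S.
have Pt : t \in filter P S.
  by rewrite mem_filter tS andbT /P ts; apply/allP => u uS; apply/implyP; apply: tmin.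
have : nearest S s \in filter P S.
  by rewrite /nearest -/P; case: (filter P S) Pt => // x l _; apply: mem_head.
rewrite mem_filter => /andP[/andP[ns /allP min] nS]; split=> // u uS us.
by have /implyP := min u uS; apply.
Qed.

(* Points at distance less than their own nearest-neighbour distance from [z]:
   two of them in a common octant around [z] would be too close to each other. *)
Lemma octant_separation (S : seq Cx) (z s t : Cx) : s \in S -> t \in S ->
  sqn (s - z) < sqn (s - nearest S s) -> sqn (t - z) < sqn (t - nearest S t) ->
  octant (s - z) = octant (t - z) -> s = t.
Proof.
wlog le : s t / sqn (s - z) <= sqn (t - z) => [H|] sS tS sz tz oct.
  have [le|lt] := lerP (sqn (s - z)) (sqn (t - z)); first exact: H.
  by apply/esym; apply: H => //; apply: ltW.
apply: contraTeq tz => ts; rewrite -leNgt.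
have hS : has (fun u => u != t) S by apply/hasP; exists s.
have [_ _ min] := nearestP hS; apply: le_trans (min s sS ts) _.
have := octant_dist oct le; congr (_ <= _); rewrite -sqnN; congr sqn; ring.
Qed.

End ComplexGeometry.

(** * Few sums, many products over the complex numbers *)

(** Cauchy-Schwarz, by summing [2 * (f u * f v) <= f u ^ 2 + f v ^ 2] over all pairs. *)
Lemma sqr_sum_leq (T : finType) (V : {set T}) (f : T -> nat) :
  ((\sum_(v in V) f v) ^ 2 <= #|V| * \sum_(v in V) f v ^ 2)%N.
Proof.
rewrite -(@leq_pmul2l 2) //.
apply: (@leq_trans (\sum_(u in V) \sum_(v in V) (f u ^ 2 + f v ^ 2))%N).
  rewrite -mulnn big_distrlr /= big_distrr; apply: leq_sum => u _.
  by rewrite big_distrr; apply: leq_sum => v _; exact: nat_Cauchy.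
under eq_bigr do rewrite big_split sum_nat_const.
by rewrite big_split /= -big_distrr sum_nat_const /=; lia.
Qed.

Lemma sum_fibers (T : finType) (U : eqType) (P : {set T}) (h : T -> U) (L : seq U) (f : T -> nat) :
  uniq L ->
  (\sum_(s <- L) \sum_(x in P | h x == s) f x = \sum_(x in P | h x \in L) f x)%N.
Proof.
move=> uL; rewrite (exchange_big_dep (fun x => x \in P)) /=; last by move=> s x _ /andP[].
rewrite [RHS]big_mkcondr; apply: eq_bigr => x xP.
rewrite (eq_bigl (pred1 (h x))) => [|s]; last by rewrite xP eq_sym.
by rewrite big_const_seq count_uniq_mem // iter_addn_0; case: ifP; rewrite ?muln1 ?muln0.
Qed.

Lemma card_dep_pairs (T U : finType) (P : {pred T}) (G : T -> {set U}) :
  (#|[set q | (q.1 \in P) && (q.2 \in G q.1)]| = \sum_(x in P) #|G x|)%N.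
Proof.
rewrite -sum1_card (eq_bigl (fun q => (q.1 \in P) && (q.2 \in G q.1))) => [|q]; last by rewrite inE.
rewrite -(pair_big_dep (mem P) (fun x y => y \in G x) (fun _ _ => 1%N)) /=.
by apply: eq_bigr => x _; rewrite sum1_card.
Qed.

Section FewSumsManyProducts.

Variables (R : rcfType) (F : finNzRingType) (B : {set F}) (phi : F -> complex R).

Hypothesis phi_neq0 : {in B, forall x, phi x != 0}.
Hypothesis phi_inj : {in B &, injective phi}.
Hypothesis phi_quadrant : {in B &, forall x y, 0 <= dotp (phi x) (phi y)}.
Hypothesis phiD : forall x y z t, x \in B -> y \in B -> z \in B -> t \in B ->
  x + y = z + t -> phi x + phi y = phi z + phi t.
Hypothesis phiM : forall x y z t, x \in B -> y \in B -> z \in B -> t \in B ->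
  x * y = z * t -> phi x * phi y = phi z * phi t.

Local Notation P := (setX B B).
Let slope (x : F * F) : complex R := phi x.2 / phi x.1.
Let mult (s : complex R) : nat := #|[set x in P | slope x == s]|.

Lemma card_sumset_ge : (#|B| <= #|sumset B B|)%N.
Proof.
have [->|[x xB]] := set_0Vmem B; first by rewrite cards0.
rewrite -(card_imset (mem B) (addrI x)); apply: subset_leq_card.
by apply/subsetP => _ /imsetP[y yB ->]; apply/imset2P; exists x y.
Qed.

(** On a line of given slope, the abscissa determines the point. *)
Lemma mult_leq s : (mult s <= #|B|)%N.
Proof.
rewrite /mult -(@card_in_imset _ _ (fun x : F * F => x.1) [set x in P | slope x == s]).
  apply: subset_leq_card; apply/subsetP => _ /imsetP[x + ->].
  by rewrite inE => /andP[]; rewrite inE => /andP[].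
move=> [x1 x2] [y1 y2]; rewrite !inE /= => /andP[/andP[x1B x2B] /eqP xs] /andP[/andP[y1B y2B] /eqP ys] e.
rewrite -e in ys *; congr (_, _); apply: phi_inj => //.
have n0 := phi_neq0 x1B; apply: (mulIf (invr_neq0 n0)); rewrite -/(slope (x1, x2)).
by rewrite [LHS]xs -ys.
Qed.

Lemma sum_fiber_const s n : (\sum_(x in P | slope x == s) n = mult s * n)%N.
Proof.
rewrite /mult -sum_nat_const; apply: eq_bigl => x.
by rewrite [in RHS]inE.
Qed.

(** * Counting slopes with many points *)

Section RichSlopes.

Variables (S : seq (complex R)) (tau : nat).
Hypothesis uniqS : uniq S.
Hypothesis S_rich : {in S, forall s, (tau <= mult s)%N}.
Hypothesis S_ge2 : (1 < size S)%N.

Let Q : {set (F * F) * (F * F)} :=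
  [set q | [&& q.1 \in P, q.2 \in P, slope q.1 \in S & slope q.2 == nearest S (slope q.1)]].

(** The vector sum is taken in [F], where it ranges over pairs from [sumset B B]; its slope and the
    octant are read in the complex plane. *)
Let code (q : (F * F) * (F * F)) : (F * F) * (bool * bool * bool) :=
  ((q.1.1 + q.2.1, q.1.2 + q.2.2),
   octant (slope q.1 - (phi q.1.2 + phi q.2.2) / (phi q.1.1 + phi q.2.1))).

Lemma S_other s : has (fun t => t != s) S.
Proof.
apply: contraLR S_ge2 => /hasPn /= Ss; rewrite -leqNgt.
apply: (@uniq_leq_size _ S [:: s]) uniqS _ => t /Ss; rewrite negbK inE; exact.
Qed.

(** The sum determines its slope [z]; [z] and the octant determine the first slope by
    [octant_separation], hence also its nearest neighbour. These two slopes differ, so the sum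
    splits uniquely along the two lines. *)
Lemma code_inj : {in Q &, injective code}.
Proof.
move=> [[a1 b1] [a2 b2]] [[c1 d1] [c2 d2]]; rewrite !inE /=.
move=> /and4P[/andP[a1B b1B] /andP[a2B b2B] sS /eqP sn].
move=> /and4P[/andP[c1B d1B] /andP[c2B d2B] tS /eqP tn].
rewrite /code => /= codeE.
have ac : a1 + a2 = c1 + c2 := congr1 (fun w => w.1.1) codeE.
have bd : b1 + b2 = d1 + d2 := congr1 (fun w => w.1.2) codeE.
have oct := congr1 snd codeE.
have acE := phiD a1B a2B c1B c2B ac; have bdE := phiD b1B b2B d1B d2B bd.
have [sS' sneq _] := nearestP (S_other (slope (a1, b1))).
have [tS' tneq _] := nearestP (S_other (slope (c1, d1))).
have st : slope (a1, b1) = slope (c1, d1).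
  apply: (@octant_separation _ S ((phi b1 + phi b2) / (phi a1 + phi a2))) => //.
  - rewrite -sn; apply: mediant_dist; rewrite ?phi_neq0 ?phi_quadrant //.
    by rewrite -[_ / _]/(slope (a1, b1)) -[X in _ != X]/(slope (a2, b2)) sn eq_sym.
  - rewrite -tn acE bdE; apply: mediant_dist; rewrite ?phi_neq0 ?phi_quadrant //.
    by rewrite -[_ / _]/(slope (c1, d1)) -[X in _ != X]/(slope (c2, d2)) tn eq_sym.
  by move: oct => /=; rewrite -acE -bdE.
rewrite -st in tn tneq.
have bE x y : x \in B -> phi y = slope (x, y) * phi x.
  by move=> xB; rewrite /slope /= divfK // phi_neq0.
set s := slope (a1, b1) in st sn sneq tn tneq sS'.
set s' := nearest S s in sn sneq tn tneq sS'.
have b1E := bE _ b1 a1B; have b2E := bE _ b2 a2B; have d1E := bE _ d1 c1B; have d2E := bE _ d2 c2B.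
rewrite -/s in b1E; rewrite sn in b2E; rewrite -st in d1E; rewrite tn in d2E.
have eq1 : (s' - s) * (phi a1 - phi c1) = 0.
  have -> : (s' - s) * (phi a1 - phi c1) = s' * (phi a1 + phi a2 - (phi c1 + phi c2))
      - (s * phi a1 + s' * phi a2 - (s * phi c1 + s' * phi c2)) by ring.
  by rewrite -b1E -b2E -d1E -d2E acE bdE !subrr mulr0 subr0.
have a1c1 : a1 = c1.
  apply: phi_inj => //; apply/eqP; rewrite -subr_eq0.
  have ss : s' - s != 0 by rewrite subr_eq0.
  by apply/eqP; apply: (mulfI ss); rewrite eq1 mulr0.
have a2c2 : a2 = c2 by move: ac; rewrite a1c1 => /addrI.
have b1d1 : b1 = d1 by apply: phi_inj => //; rewrite b1E d1E a1c1.
have b2d2 : b2 = d2 by move: bd; rewrite b1d1 => /addrI.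
by rewrite a1c1 a2c2 b1d1 b2d2.
Qed.

Lemma card_Q_leq : (#|Q| <= 8 * #|sumset B B| ^ 2)%N.
Proof.
rewrite -(card_in_imset code_inj).
apply: (@leq_trans #|setX (setX (sumset B B) (sumset B B)) [set: bool * bool * bool]|).
  apply: subset_leq_card; apply/subsetP => _ /imsetP[q + ->]; rewrite !inE /=.
  move=> /and4P[/andP[a1B b1B] /andP[a2B b2B] _ _]; rewrite andbT.
  by apply/andP; split; apply/imset2P; [exists q.1.1 q.2.1|exists q.1.2 q.2.2].
by rewrite !cardsX cardsT !card_prod card_bool mulnn mulnC.
Qed.

Lemma card_Q_geq : (size S * tau ^ 2 <= #|Q|)%N.
Proof.
have -> : (#|Q| = \sum_(x in P | slope x \in S) mult (nearest S (slope x)))%N.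
  rewrite -(card_dep_pairs [pred x | (x \in P) && (slope x \in S)]
    (fun x => [set y in P | slope y == nearest S (slope x)])).
  by apply: eq_card => q; rewrite !inE /= -!andbA; do !bool_congr.
apply: (@leq_trans (\sum_(x in P | slope x \in S) tau)%N).
  rewrite -(@sum_fibers _ _ P slope S (fun=> tau) uniqS).
  have -> : (size S * tau ^ 2 = \sum_(s <- S) tau ^ 2)%N.
    by rewrite big_const_seq count_predT iter_addn_0 mulnC.
  rewrite !big_seq; apply: leq_sum => s /S_rich sm.
  by rewrite sum_fiber_const -mulnn leq_mul2r sm orbT.
apply: leq_sum => x /andP[_ xS]; apply: S_rich.
by have [] := nearestP (S_other (slope x)).
Qed.

End RichSlopes.

Lemma rich_slopes S tau : uniq S -> {in S, forall s, (tau <= mult s)%N} ->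
  (size S * tau ^ 2 <= 8 * #|sumset B B| ^ 2)%N.
Proof.
move=> uS rS; have [S2|] := ltnP 1 (size S).
  exact: leq_trans (card_Q_geq uS rS S2) (card_Q_leq uS S2).
(* A single slope has no neighbour, but its line carries at most [|B| <= |B + B|] points. *)
case: S uS rS => [|s [|//]] // _ rS _; rewrite mul1n.
apply: (@leq_trans (#|sumset B B| ^ 2)%N); last by rewrite leq_pmull.
rewrite leq_exp2r //; apply: leq_trans (rS s (mem_head _ _)) _.
exact: leq_trans (mult_leq s) card_sumset_ge.
Qed.

(** The sum is that of [mult s ^ 2] over the slopes. Those with [2 ^ i <= mult s < 2 ^ i.+1]
    contribute at most [4 * 8 * |B + B| ^ 2] by [rich_slopes], and there are [trunc_log 2 #|B| + 1]
    dyadic levels. *)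
Lemma slope_energy_leq :
  (\sum_(x in P) mult (slope x) <= 32 * #|sumset B B| ^ 2 * (trunc_log 2 #|B|).+1)%N.
Proof.
set N := trunc_log 2 #|B|.
have lv x : (trunc_log 2 (mult (slope x)) < N.+1)%N.
  by rewrite ltnS; apply: leq_trunc_log; apply: mult_leq.
rewrite (partition_big (fun x => Ordinal (lv x)) xpredT) //=.
rewrite mulnC -[X in (_ <= X * _)%N]card_ord -sum_nat_const.
apply: leq_sum => i _.
pose S := undup [seq slope x | x <- enum P & trunc_log 2 (mult (slope x)) == i].
have memS x : x \in P -> (slope x \in S) = (trunc_log 2 (mult (slope x)) == i).
  move=> xP; rewrite mem_undup; apply/mapP/idP => [[y + ->]|xi].
    by rewrite mem_filter => /andP[].
  by exists x => //; rewrite mem_filter xi mem_enum.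
have Si s : s \in S -> (2 ^ i <= mult s < 2 ^ i.+1)%N.
  rewrite mem_undup => /mapP[x + ->]; rewrite mem_filter => /andP[/eqP xi].
  rewrite mem_enum => xP; have m0 : (0 < mult (slope x))%N.
    by apply/card_gt0P; exists x; rewrite inE xP eqxx.
  by rewrite -xi; apply: trunc_log_bounds.
have uS : uniq S by apply: undup_uniq.
apply: (@leq_trans (\sum_(x in P | slope x \in S) 2 ^ i.+1)%N).
  rewrite [leqLHS](eq_bigl (fun x => (x \in P) && (slope x \in S))); last first.
    by move=> x; case: (boolP (x \in P)) => //= xP; rewrite memS.
  by apply: leq_sum => x /andP[_ /Si /andP[_ /ltnW]].
rewrite -(@sum_fibers _ _ P slope S (fun=> 2 ^ i.+1)%N uS).
apply: (@leq_trans (\sum_(s <- S) 2 ^ i.+1 * 2 ^ i.+1)%N).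
  rewrite !big_seq; apply: leq_sum => s /Si /andP[_ /ltnW sm].
  by rewrite sum_fiber_const leq_mul2r sm orbT.
rewrite big_const_seq count_predT iter_addn_0 -expnD.
have := rich_slopes uS (fun s sS => proj1 (andP (Si s sS))).
rewrite -expnM muln2 -addnn addSn addnS !expnS; lia.
Qed.

(** Cauchy-Schwarz compares [|B| ^ 4] with [|B B|] times the number of solutions of [a b = c d];
    distinct solutions give distinct pairs of points of equal slope. *)
Lemma mult_energy_leq :
  (#|B| ^ 4 <= #|prodset B B| * \sum_(x in P) mult (slope x))%N.
Proof.
pose V := prodset B B.
pose r v := #|[set x in P | x.1 * x.2 == v]|.
have -> : (#|B| ^ 4 = (\sum_(v in V) r v) ^ 2)%N.
  suff -> : (\sum_(v in V) r v = #|B| ^ 2)%N by rewrite -expnM.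
  rewrite -mulnn -cardsX -sum1_card (partition_big (fun x : F * F => x.1 * x.2) (mem V)) /=.
    apply: eq_bigr => v _; rewrite /r -sum1_card; apply: eq_bigl => x.
    by rewrite inE.
  by move=> [x y]; rewrite inE /= => /andP[xB yB]; apply/imset2P; exists x y.
apply: leq_trans (sqr_sum_leq V r) _; rewrite leq_mul2l; apply/orP; right.
pose E1 := [set q : (F * F) * (F * F) | [&& q.1 \in P, q.2 \in P & q.1.1 * q.1.2 == q.2.1 * q.2.2]].
pose E2 := [set q : (F * F) * (F * F) | [&& q.1 \in P, q.2 \in P & slope q.1 == slope q.2]].
have -> : (\sum_(v in V) r v ^ 2 = #|E1|)%N.
  have -> : #|E1| = (\sum_(x in P) r (x.1 * x.2)%R)%N.
    rewrite -(card_dep_pairs (mem P) (fun x => [set y in P | y.1 * y.2 == x.1 * x.2])).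
    by apply: eq_card => q; rewrite !inE /= [_ * _ == _]eq_sym.
  rewrite [RHS](partition_big (fun x : F * F => x.1 * x.2) (mem V)) /=; last first.
    by move=> [x y]; rewrite inE /= => /andP[xB yB]; apply/imset2P; exists x y.
  apply: eq_bigr => v _; rewrite (eq_bigr (fun=> r v)) => [|x /andP[_ /eqP -> //]].
  rewrite -mulnn -sum_nat_const; apply: eq_bigl => x; by rewrite inE.
have -> : (\sum_(x in P) mult (slope x) = #|E2|)%N.
  rewrite -(card_dep_pairs (mem P) (fun x => [set y in P | slope y == slope x])).
  by apply: eq_card => q; rewrite !inE /= [slope q.2 == _]eq_sym.
(* [a b = c d] gives [phi b / phi c = phi d / phi a] *)
pose sw (q : (F * F) * (F * F)) := ((q.2.1, q.1.2), (q.1.1, q.2.2)).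
have swi : injective sw by move=> [[a b] [c d]] [[a' b'] [c' d']] [-> -> -> ->].
rewrite -(card_imset _ swi); apply: subset_leq_card; apply/subsetP => _ /imsetP[[[a b] [c d]] + ->].
rewrite !inE /= => /and3P[/andP[aB bB] /andP[cB dB] /eqP e].
rewrite aB bB cB dB /= /slope /=.
rewrite eqr_div ?phi_neq0 // mulrC (phiM aB bB cB dB e) mulrC eqxx //.
Qed.

Theorem few_sums_many_products :
  (#|B| ^ 4 <= #|prodset B B| * (32 * #|sumset B B| ^ 2 * (trunc_log 2 #|B|).+1))%N.
Proof.
by apply: leq_trans mult_energy_leq _; rewrite leq_mul2l slope_energy_leq orbT.
Qed.

End FewSumsManyProducts.

(** * The theorem in prime fields *)

Lemma Fp_intr_eq0 (p M : nat) : prime p -> (M < p)%N ->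
  forall z : int, (`|z| <= M)%N -> z%:~R = 0 :> 'F_p -> z = 0.
Proof.
move=> pp Mp z zM z0.
have : (`|z|%:R : 'F_p) == 0.
  case: z zM z0 => n _ /eqP //=.
  by rewrite NegzE rmorphN oppr_eq0.
rewrite -(dvdn_pcharf (pchar_Fp pp)) => /dvdn_leq; case: (posnP `|z|) => [/eqP|z_gt0 /(_ isT)].
  by rewrite absz_eq0 => /eqP.
by rewrite leqNgt (leq_ltn_trans zM Mp).
Qed.

(** After transfer to the complex numbers, the most populated of the four quadrants keeps at least a
    quarter of [A] and makes all dot products nonnegative. *)
Lemma few_sums_subset (R : rcfType) (p m : nat) (A : {set 'F_p}) : prime p -> #|A| = m ->
  0 \notin A -> (2 ^ elim_deg m.+1 (m ^ 2 + m + 2) < p)%N ->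
  exists B : {set 'F_p}, [/\ B \subset A, (m <= 4 * #|B|)%N &
    (#|B| ^ 4 <= #|prodset B B| * (32 * #|sumset B B| ^ 2 * (trunc_log 2 #|B|).+1))%N].
Proof.
move=> pp cA A0 /(Fp_intr_eq0 pp) kz.
pose s := enum A; have ss : size s = m by rewrite -cardE.
have sA i : (i < m)%N -> s`_i \in A by move=> im; rewrite -mem_enum mem_nth ?ss.
have [||b [b0 binj bD bM]] := @transfer_ring_relations 'F_p (complex R) m (fun i => s`_i) kz.
- by move=> i im; apply: contraNneq A0 => <-; apply: sA.
- by move=> i j im jm; apply: contraNneq => /eqP; rewrite nth_uniq ?ss ?enum_uniq.
pose phi x := b (index x s).
have sm x : x \in A -> (index x s < m)%N by rewrite -mem_enum -/s -index_mem ss.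
have nthi x : x \in A -> s`_(index x s) = x by move=> xA; rewrite nth_index ?mem_enum.
pose quad x := (0 <= complex.Re (phi x), 0 <= complex.Im (phi x)).
pose Bq q := [set x in A | quad x == q].
have [q qm] : exists q, (m <= 4 * #|Bq q|)%N.
  apply: NNPP => noq.
  have : (\sum_(q : bool * bool) 4 * #|Bq q| < \sum_(q : bool * bool) m)%N.
    rewrite (bigD1 (true, true)) //= [ltnRHS](bigD1 (true, true)) //= -addSn.
    apply: leq_add; first by rewrite ltnNge; apply/negP => h; apply: noq; exists (true, true).
    apply: leq_sum => q _; apply/ltnW; rewrite ltnNge; apply/negP => h.
    by apply: noq; exists q.
  rewrite sum_nat_const card_prod card_bool -big_distrr /=.
  suff -> : (\sum_q #|Bq q| = m)%N by rewrite ltnn.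
  rewrite -cA -sum1_card (partition_big quad xpredT) //=.
  by apply: eq_bigr => q _; rewrite -sum1_card; apply: eq_bigl => x; rewrite inE.
have BA : Bq q \subset A by apply/subsetP => x; rewrite inE => /andP[].
have BP x : x \in Bq q -> x \in A := subsetP BA x.
exists (Bq q); split=> //; apply: (@few_sums_many_products R _ _ phi).
- by move=> x /BP xA; apply: b0; apply: sm.
- move=> x y /BP xA /BP yA; apply: contra_eq => xy; apply: binj; rewrite ?sm //.
  by apply: contraNneq xy => e; rewrite -(nthi x) // e nthi.
- move=> x y; rewrite !inE => /andP[_ /eqP qx] /andP[_ /eqP qy].
  move: qx; rewrite -qy /quad /dotp => -[].
  case: lerP => h1; case: lerP => // h2 _; case: lerP => h3; case: lerP => // h4 _; nra.
- by move=> x y z t /BP xA /BP yA /BP zA /BP tA e; apply: bD; rewrite ?sm // !nthi.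
by move=> x y z t /BP xA /BP yA /BP zA /BP tA e; apply: bM; rewrite ?sm // !nthi.
Qed.

(** The closed form is at most [2 ^ ((m + 3) * 3 ^ m.+1)], whose exponent is at most
    [2 ^ (m + 2) * 4 ^ m.+1 = 2 ^ (3 * m + 4)]. *)
Lemma elim_deg_bound m n : (3 * m + 3 <= n)%N ->
  (elim_deg m.+1 (m ^ 2 + m + 2) <= 8 ^ (2 ^ n.+1))%N.
Proof.
move=> mn; set D := (m ^ 2 + m + 2)%N.
have D2 : (D <= 2 ^ m.+1)%N.
  rewrite /D; elim: m {mn D} => // m IH.
  have [m2|] := ltnP 1 m; first by rewrite [(2 ^ m.+2)%N]expnS -mulnn; move: IH; rewrite -mulnn; nia.
  by case: m {IH} => [|[|]].
apply: (@leq_trans (4 * elim_deg m.+1 D)); first by rewrite leq_pmull.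
rewrite elim_degE; apply: (@leq_trans ((2 ^ m.+3) ^ (3 ^ m.+1))%N).
  rewrite leq_exp2r ?expn_gt0 // -[m.+3]/(2 + m.+1)%N expnD.
  by rewrite leq_mul2l D2 orbT.
rewrite -[8%N]/(2 ^ 3)%N -!expnM leq_pexp2l //.
apply: (@leq_trans (2 ^ (m + 2) * 2 ^ (2 * m.+1))%N).
  apply: leq_mul; first by rewrite addn2 ltn_expl.
  by rewrite expnM leq_exp2r.
rewrite -expnD; apply: (@leq_trans (2 ^ n.+1)%N); last by rewrite leq_pmull.
by rewrite leq_pexp2l //; lia.
Qed.

(** The requirements on the size of the subset: comparable to [n], available after removing 0, and
    within reach of [elim_deg_bound]. *)
Lemma divn8_bounds n : (8 <= n)%N ->
  [/\ n <= 16 * (n %/ 8), n %/ 8 <= n.-1 & 3 * (n %/ 8) + 3 <= n]%N.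
Proof. by split; lia. Qed.

(** * Real and integer logarithms *)

Section Logarithms.

Variable R : realType.

Lemma logb_gt (b t : nat) (x : R) : (1 < b)%N -> t%:R < logb b%:R x -> (b ^ t)%:R < x.
Proof.
move=> b1; have lb : 0 < ln (b%:R : R) by rewrite ln_gt0 // ltr1n.
rewrite /logb ltr_pdivlMr // => tx.
(* For [x <= 0] the logarithm is 0 by convention, which is not above [t]. *)
have x0 : 0 < x.
  rewrite ltNge; apply/negP => /ln0 x0; move: tx; rewrite x0 ltNge.
  by rewrite mulr_ge0 // ltW.
have b0 : 0 < (b%:R : R) by rewrite ltr0n ltnW.
by rewrite natrX -ltr_ln ?posrE ?exprn_gt0 // lnXn // -[X in X < _]mulr_natl.
Qed.

Lemma tower_lt (p n : nat) :
  n%:R < logb 2 (logb 8 (logb 32 (p%:R : R))) - 1 -> (32 ^ (8 ^ (2 ^ n.+1)) < p)%N.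
Proof.
move=> h; have : n.+1%:R < logb 2%:R (logb 8 (logb 32 (p%:R : R))) by rewrite -natr1; lra.
move=> /(@logb_gt 2 _ _ isT)/(@logb_gt 8 _ _ isT)/(@logb_gt 32 _ _ isT).
by rewrite ltr_nat.
Qed.

Lemma trunc_log_ln (n : nat) : (2 <= n)%N -> ((trunc_log 2 n).+1)%:R * ln 2 <= 2 * ln (n%:R : R).
Proof.
move=> n2; have n0 : (0 < n)%N by apply: leq_trans n2.
have h1 : (trunc_log 2 n)%:R * ln 2 <= ln (n%:R : R).
  rewrite mulr_natl -lnXn // -natrX ler_ln ?posrE ?ltr0n ?expn_gt0 //.
  by rewrite ler_nat trunc_logP.
have h2 : ln 2 <= ln (n%:R : R) by rewrite ler_ln ?posrE ?ltr0n // ler_nat.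
by rewrite -natr1 mulrDl mul1r; lra.
Qed.

End Logarithms.

Theorem theorem4p2 (R : realType) (C : R) (C_gt0 : 0 < C) :
  exists2 c : R, 0 < c &
    forall (p : nat) (A : {set 'F_p}) (n : nat),
      prime p ->
      #|A| = n ->
      n%:R < logb 2 (logb 8 (logb 32 (p%:R : R))) - 1 ->
      #|sumset A A|%:R <= C * n%:R ->
      c * n%:R ^+ 2 / ln n%:R <= #|prodset A A|%:R.
Proof.
have l2 : 0 < ln (2 : R) by rewrite ln_gt0 // ltr1n.
have C2 : 0 < C ^+ 2 by rewrite exprn_gt0.
(* [c1] serves [8 <= n]: [64 ^ 4] comes from [n <= 64 * |B|], with [64 = 16 * 4], and the last 64 is
   32 from the energy bound times 2 from [trunc_log_ln]. [c2] serves [n < 8], where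
   [n ^ 2 <= 64]. *)
pose c1 := ln 2 / (64 ^+ 5 * C ^+ 2); pose c2 : R := ln 2 / 64.
exists (Num.min c1 c2) => [|p A n pp cA hp hC].
  by rewrite lt_min !divr_gt0 ?mulr_gt0 ?exprn_gt0.
(* Here [ln n] is 0, and division by 0 gives 0. *)
have [n2|n2] := ltnP n 2.
  have -> : ln (n%:R : R) = 0 by case: n n2 {cA hp hC} => [|[|]] // _; rewrite ?ln1 ?ln0.
  by rewrite invr0 mulr0.
have ln_n : ln 2 <= ln (n%:R : R) by rewrite ler_ln ?posrE ?ltr0n ?ler_nat // ltnW.
have ln0 : 0 < ln (n%:R : R) by apply: lt_le_trans ln_n.
rewrite ler_pdivrMr //.
have [n8|n8] := ltnP n 8.
  have A1 : (1 <= #|prodset A A|)%N.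
    have /card_gt0P [x xA] : (0 < #|A|)%N by rewrite cA ltnW.
    by apply/card_gt0P; exists (x * x); apply/imset2P; exists x x.
  apply: (@le_trans _ _ (c2 * 64)).
    apply: ler_pM; rewrite ?le_min ?ge_min ?lexx ?orbT ?sqr_ge0 //.
      by rewrite !ltW // divr_gt0 ?mulr_gt0 ?exprn_gt0.
    by rewrite -natrX ler_nat; nia.
  rewrite /c2 divfK ?pnatr_eq0 //; apply: le_trans ln_n _.
  by rewrite ler_peMl ?ler1n // ltW.
pose m := (n %/ 8)%N.
have [nm m1 m3] := divn8_bounds n8.
have [A' A'A cA'] : exists2 A' : {set 'F_p}, A' \subset A :\ 0 & #|A'| = m.
  have /card_geqP[s [us sm sA]] : (m <= #|A :\ (0 : 'F_p)%R|)%N.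
    apply: (@leq_trans n.-1); first exact: m1.
    by rewrite -cA (cardsD1 (0 : 'F_p) A); case: (_ \in _) => /=; rewrite ?add0n ?leq_pred.
  exists [set x in s]; last by rewrite cardsE (card_uniqP us).
  by apply/subsetP => x; rewrite inE => /sA.
have A'0 : 0 \notin A' by apply/negP => /(subsetP A'A); rewrite !inE eqxx.
have [|B [BA' mB hB]] := @few_sums_subset R p m A' pp cA' A'0.
  have := tower_lt hp; apply: leq_ltn_trans.
  apply: (@leq_trans (2 ^ (8 ^ (2 ^ n.+1)))%N); last by rewrite leq_exp2r ?expn_gt0.
  by rewrite leq_pexp2l // elim_deg_bound.
have BA : B \subset A by apply: subset_trans BA' (subset_trans A'A (subsetDl _ _)).
have sB : (#|sumset B B| <= #|sumset A A|)%N by apply/subset_leq_card/imset2S.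
have pB : (#|prodset B B| <= #|prodset A A|)%N by apply/subset_leq_card/imset2S.
have cB : (#|B| <= n)%N by rewrite -cA subset_leq_card.
have nB : (n <= 64 * #|B|)%N.
  by apply: leq_trans nm _; rewrite -[64%N]/(16 * 4)%N -mulnA leq_mul2l mB.
have key : (n ^ 4 <= 64 ^ 4 * (#|prodset A A| * (32 * #|sumset A A| ^ 2 * (trunc_log 2 n).+1)))%N.
  apply: (@leq_trans ((64 * #|B|) ^ 4)%N); first by rewrite leq_exp2r.
  rewrite expnMn leq_mul2l; apply/orP; right; apply: leq_trans hB _.
  apply: leq_mul => //; apply: leq_mul; first by rewrite leq_mul2l leq_exp2r // sB orbT.
  by rewrite ltnS leq_trunc_log.
set X := #|prodset A A| in key *; set S := #|sumset A A| in key hC.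
set L := (trunc_log 2 n).+1 in key.
have keyR : (n%:R : R) ^+ 4 <= 64 ^+ 4 * (X%:R * (32 * S%:R ^+ 2 * L%:R)).
  move: key; rewrite -(ler_nat R) (natrX _ n) (natrM _ (64 ^ 4)%N) (natrX _ 64).
  by rewrite (natrM _ X) (natrM _ _ L) (natrM _ 32) (natrX _ S).
have n0 : 0 < (n%:R : R) by rewrite ltr0n ltnW.
have SC : (S%:R : R) ^+ 2 <= C ^+ 2 * n%:R ^+ 2.
  by rewrite -exprMn lerXn2r ?nnegrE // mulr_ge0 // ltW.
have LL : (L%:R : R) * ln 2 <= 2 * ln n%:R by apply: trunc_log_ln.
apply: (@le_trans _ _ (c1 * n%:R ^+ 2)).
  by rewrite ler_wpM2r ?sqr_ge0 // ge_min lexx.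
have n4 : 0 < (n%:R : R) ^+ 2 by rewrite exprn_gt0.
(* Multiplied by [n ^ 2], the claim becomes a bound on [n ^ 4], to be compared with [keyR]. *)
rewrite -(ler_pM2r n4) -mulrA -exprD /c1 mulrAC ler_pdivrMr ?mulr_gt0 ?exprn_gt0 //.
apply: (@le_trans _ _ (ln 2 * (64 ^+ 4 * (X%:R * (32 * (C ^+ 2 * n%:R ^+ 2) * L%:R))))).
  rewrite ler_pM2l //; apply: le_trans keyR _.
  rewrite !ler_wpM2l //; first by rewrite exprn_ge0.
  by rewrite ler_wpM2r // ler_wpM2l.
have -> : ln 2 * (64 ^+ 4 * (X%:R * (32 * (C ^+ 2 * n%:R ^+ 2) * L%:R))) =
  (64 ^+ 4 * 32 * X%:R * C ^+ 2 * n%:R ^+ 2) * (L%:R * ln 2) by ring.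
have -> : X%:R * ln n%:R * n%:R ^+ 2 * (64 ^+ 5 * C ^+ 2) =
  (64 ^+ 4 * 32 * X%:R * C ^+ 2 * n%:R ^+ 2) * (2 * ln n%:R) by ring.
by apply: ler_wpM2l => //; rewrite !mulr_ge0 // ?exprn_ge0 // ltW.
Qed.
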